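(* Let $G$ and $H$ be graph states on $n$ qupits with label matrices $M$ and $N$ over $\mathbb F_p$. Then $G$ and $H$ are equivalent under the local Clifford group if and only if $N$ can be obtained from $M$ by a finite sequence of the operations $\circ_b v$ ($v$ a vertex, $0\ne b\in\mathbb F_p$) and $*_a v$ ($v$ a vertex, $a\in\mathbb F_p$).
   Context: $p$ is an odd prime, $\omega=e^{2\pi i/p}$; on $\mathbb C^p$ with basis $\{|x\rangle\}_{x\in\mathbb F_p}$, $X(a)|x\rangle=|x+a\rangle$, $Z(b)|x\rangle=\omega^{bx}|x\rangle$; $X(\mathbf a)=\bigotimes_iX(\mathbf a_i)$, $Z(\mathbf b)=\bigotimes_iZ(\mathbf b_i)$; $\mathcal G_n=\{\omega^cX(\mathbf a)Z(\mathbf b)\}$. The Clifford group $\mathcal C$ is the normalizer of $\mathcal G_1$; the local Clifford group is $\mathcal C^{\otimes n}$; two states are equivalent under it if some $h\in\mathcal C^{\otimes n}$ maps one to a scalar multiple of the other. A graph state with label matrix $M$ ($M$ symmetric $n\times n$ over $\mathbb F_p$ with zero diagonal) is the common $1$-eigenvector of an abelian subgroup of $\mathcal G_n$ containing no nontrivial scalar, generated by operators $\omega^{c_i}X(\mathbf e_i)Z(M_i)$, $i=1,\dots,n$, where $\mathbf e_i$ is the $i$-th standard basis vector and $M_i$ the $i$-th row of $M$ (i.e. with generator matrix $(\mathrm{Id}_n\mid M)$); it is identified with the labeled graph on $\{1,\dots,n\}$ whose edge $\{i,j\}$ has label $M_{ij}$. Operations: for a vertex $v$ and $0\neq b\in\mathbb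 F_p$, $G\circ_b v$ has label matrix $I(v,b)\,M\,I(v,b)$, where $I(v,b)=\mathrm{diag}(1,\dots,1,b,1,\dots,1)$ with $b$ in position $v$. For a vertex $v$ and $a\in\mathbb F_p$, $G*_a v$ has label matrix $M'$ with $M'_{jk}=M_{jk}+aM_{vj}M_{vk}$ for $j\ne k$ and $M'_{jj}=0$. *)

(* Defs.v *)
From HB Require Import structures.
From mathcomp Require Import all_boot all_order all_algebra all_field.
From mathcomp Require Import complex.
From mathcomp Require Import Rstruct.
From Stdlib Require Import Relations.
From Stdlib Require Rtrigo_def Rtrigo1.
Set Implicit Arguments. Unset Strict Implicit. Unset Printing Implicit Defensive.
Import GRing.Theory Num.Theory.
Local Open Scope ring_scope.

Definition CC : Type := (Rdefinitions.R)[i].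

Definition omega (p : nat) : CC :=
  Complex (Rtrigo_def.cos (2 * Rtrigo1.PI / p%:R : Rdefinitions.R))
          (Rtrigo_def.sin (2 * Rtrigo1.PI / p%:R : Rdefinitions.R)).

(* Linear operators on C^T (T a finite basis), given by their matrix entries:
   op y x = <y| op |x>. *)
Definition op (T : finType) := T -> T -> CC.

Definition opmul (T : finType) (A B : op T) : op T :=
  fun y x => \sum_(z : T) A y z * B z x.
Definition opadj (T : finType) (A : op T) : op T := fun y x => (A x y)^*.
Definition opid (T : finType) : op T := fun y x => (y == x)%:R.
Definition opscale (T : finType) (c : CC) (A : op T) : op T := fun y x => c * A y x.
Definition opapply (T : finType) (A : op T) (psi : T -> CC) : T -> CC :=
  fun y => \sum_(x : T) A y x * psi x.

Section Qupit.
Variable p : nat.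

Definition Xop (a : 'F_p) : op 'F_p := fun y x => (y == x + a)%:R.
Definition Zop (b : 'F_p) : op 'F_p :=
  fun y x => (y == x)%:R * omega p ^+ (b * x)%R.

Definition pauli1 (c a b : 'F_p) : op 'F_p :=
  opscale (omega p ^+ c) (opmul (Xop a) (Zop b)).

Definition op_eq (T : finType) (A B : op T) := forall y x, A y x = B y x.

Definition unitary (T : finType) (h : op T) := op_eq (opmul h (opadj h)) (@opid T).

Definition clifford (h : op 'F_p) : Prop :=
  unitary h /\
  forall c a b : 'F_p, exists c' a' b' : 'F_p,
    op_eq (opmul (opmul h (pauli1 c a b)) (opadj h)) (pauli1 c' a' b').

Variable n : nat.
Definition basis_n := {ffun 'I_n -> 'F_p}.

Definition tensorop (hs : 'I_n -> op 'F_p) : op basis_n :=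
  fun y x => \prod_(i < n) hs i (y i) (x i).

Definition Xn (a : basis_n) := tensorop (fun i => Xop (a i)).
Definition Zn (b : basis_n) := tensorop (fun i => Zop (b i)).

Definition label_matrix (M : 'M['F_p]_n) := M^T = M /\ forall i, M i i = 0.

Definition unit_vec (i : 'I_n) : basis_n := [ffun j => (j == i)%:R].
Definition row_vec (M : 'M['F_p]_n) (i : 'I_n) : basis_n := [ffun j => M i j].

Definition graph_gen (M : 'M['F_p]_n) (c : 'I_n -> 'F_p) (i : 'I_n) :=
  opscale (omega p ^+ c i) (opmul (Xn (unit_vec i)) (Zn (row_vec M i))).

Definition graph_state (M : 'M['F_p]_n) (psi : basis_n -> CC) : Prop :=
  (exists x, psi x != 0) /\
  exists c : 'I_n -> 'F_p, forall i y, opapply (graph_gen M c i) psi y = psi y.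

Definition LC_equiv (psi phi : basis_n -> CC) : Prop :=
  exists hs : 'I_n -> op 'F_p, (forall i, clifford (hs i)) /\
  exists lam : CC, forall y, opapply (tensorop hs) psi y = lam * phi y.

Definition Ivb (v : 'I_n) (b : 'F_p) : 'M['F_p]_n :=
  diag_mx (\row_j (if j == v then b else 1)).
Definition circ_op (M : 'M['F_p]_n) (v : 'I_n) (b : 'F_p) : 'M['F_p]_n :=
  Ivb v b *m M *m Ivb v b.
Definition star_op (M : 'M['F_p]_n) (v : 'I_n) (a : 'F_p) : 'M['F_p]_n :=
  \matrix_(j, k) (if j == k then 0 else M j k + a * M v j * M v k).

Definition graph_step (M M' : 'M['F_p]_n) : Prop :=
  exists v : 'I_n,
    (exists b : 'F_p, b != 0 /\ M' = circ_op M v b) \/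
    (exists a : 'F_p, M' = star_op M v a).

Definition graph_reach (M N : 'M['F_p]_n) : Prop := @clos_refl_trans _ graph_step M N.

End Qupit.

(* Main.v *)
Require Import Defs.
From mathcomp Require Import all_boot all_order all_algebra all_field.
From mathcomp Require Import complex Rstruct ring.
From Stdlib Require Import Relations FunctionalExtensionality.
From Stdlib Require Rtrigo_def Rtrigo1 Cos_plus.
Set Implicit Arguments. Unset Strict Implicit. Unset Printing Implicit Defensive.
Import GRing.Theory Num.Theory.
Local Open Scope ring_scope.

(** Writing [chi x = omega ^ x], a graph state with label matrix [M] is
    proportional to [y |-> chi (y^T M y / 2 + d . y)] for some [d].

    From operations to Clifford operators: [G o_b v] is the substitution
    [y_v := b y_v]; [G *_a v] is the convolution at [v] with the Gaussian
    [chi (s t^2)], [2 a s = -1], followed by quadratic phases that remove the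
    diagonal created by completing the square.

    From Clifford operators to operations: conjugation by the factor at [i] acts
    on [X(a)Z(b)] by a matrix [al i, be i; ga i, de i] of determinant 1. Applying
    it to the generators of [M] and comparing with the state of [N] gives
    [diag be + M diag de = (diag al + M diag ga) N]. An induction on the number
    of [i] with [ga i <> 0] then reduces to [ga = 0], where [N] is a diagonal
    congruence of [M]. *)

(** * Local symplectic maps and local complementation *)

Section LocalSymplectic.
Variables p n : nat.
Implicit Types (M N : 'M['F_p]_n) (al be ga de : 'I_n -> 'F_p).

(** A factor [*+ (j == k)] marks an entry of a diagonal matrix. The last equation says that row [j]
    of [(Id | M)], once transformed locally, is the combination of the rows of [(Id | N)] whose
    coefficients are its X-part. *)
Definition local_symplectic M N al be ga de : Prop :=
  (forall i, al i * de i - be i * ga i = 1) /\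
  forall j k, be j *+ (j == k) + M j k * de k =
    \sum_l (al j *+ (j == l) + M j l * ga l) * N l k.

Lemma label_matrix_sym M : label_matrix M -> forall i j, M i j = M j i.
Proof. by case=> MT _ i j; rewrite -[in LHS]MT mxE. Qed.

Lemma star_label_matrix M v a : label_matrix M -> label_matrix (star_op M v a).
Proof.
move=> lM; have sM := label_matrix_sym lM; split; last by move=> i; rewrite mxE eqxx.
by apply/matrixP=> i j; rewrite !mxE eq_sym; case: eqP => // _; rewrite (sM j i); ring.
Qed.

(** Both sides of the matrix equation undergo the same row operation: row [j] loses [s * M v j]
    times row [v]. The terms in [M v k ^+ 2] compensate for the diagonal that [star_op] resets to 0.
    Since [M v v = 0], each local change is a shear and preserves the determinant. *)
Lemma local_symplectic_star M N al be ga de v s :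
  label_matrix M -> local_symplectic M N al be ga de ->
  local_symplectic (star_op M v (- s)) N
    (fun k => al k - s * M v k ^+ 2 * ga k)
    (fun k => be k - s * M v k ^+ 2 * de k)
    (fun k => ga k - (s * al k) *+ (k == v))
    (fun k => de k - (s * be k) *+ (k == v)).
Proof.
move=> lM [det1 eqAB]; have sM := label_matrix_sym lM.
have M0 i : M i i = 0 by case: lM.
have rowE x y j k :
  (x j - s * M v j ^+ 2 * y j) *+ (j == k) +
    star_op M v (- s) j k * (y k - (s * x k) *+ (k == v)) =
  x j *+ (j == k) + M j k * y k
    - s * M v j * (x v *+ (v == k) + M v k * y k).
  rewrite mxE; case: (eqVneq j k) => [<-|jk].
    case: (eqVneq j v) => [->|jv]; rewrite ?M0 /=; first by ring.
    by rewrite /=; ring.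
  case: (eqVneq k v) => [kv|kv]; rewrite /=.
    by subst k; rewrite M0 (sM v j) /=; ring.
  by rewrite /=; ring.
split=> [i|j k].
  rewrite -(det1 i); case: (eqVneq i v) => [->|_]; rewrite ?M0 ?mulr1n ?mulr0n; ring.
rewrite rowE; under eq_bigr => l _ do rewrite rowE mulrBl -mulrA.
by rewrite sumrB -mulr_sumr -!eqAB.
Qed.

Lemma graph_reach_scale M N (f : 'I_n -> 'F_p) :
  (forall i, f i != 0) -> (forall i j, N i j = f i * M i j * f j) ->
  graph_reach M N.
Proof.
move=> f0 NE.
(* Vertices are scaled one at a time; [s] lists those already treated. *)
pose g (s : seq 'I_n) i := if i \in s then f i else 1.
suff reach s : uniq s -> graph_reach M (\matrix_(i, j) (g s i * M i j * g s j)).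
  have := reach _ (enum_uniq 'I_n); congr graph_reach.
  by apply/matrixP=> i j; rewrite mxE NE /g !mem_enum.
elim: s => [_|v s IHs /= /andP[vs /IHs{}IHs]].
  rewrite (_ : (\matrix_(i, j) _) = M); first exact: rt_refl.
  by apply/matrixP=> i j; rewrite mxE /g !in_nil mul1r mulr1.
apply: rt_trans IHs _; apply: rt_step; exists v; left; exists (f v); split=> //.
rewrite /circ_op /Ivb; apply/matrixP=> i j; rewrite mul_mx_diag mul_diag_mx !mxE /g.
rewrite !inE.
by case: (eqVneq i v) => [->|_]; case: (eqVneq j v) => [->|_]; rewrite ?(negPf vs) /=; ring.
Qed.

(** Off the diagonal the equation reads [M j k * de k = al j * N j k], and [al j] is the inverse of
    [de j]; hence [N] is [M] scaled by [de] on both sides. *)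
Lemma local_symplectic_reach_free M N al be ga de :
  label_matrix M -> label_matrix N -> local_symplectic M N al be ga de ->
  (forall i, ga i = 0) -> graph_reach M N.
Proof.
move=> [_ M0] [_ N0] [det1 eqAB] ga0.
have alde i : al i * de i = 1 by rewrite -(det1 i) ga0 mulr0 subr0.
have de0 i : de i != 0.
  by apply: contra_eq_neq (alde i) => ->; rewrite mulr0 eq_sym oner_neq0.
apply: (graph_reach_scale de0) => j k.
have := eqAB j k; rewrite (bigD1 j) //= eqxx ga0 mulr0 addr0 mulr1n big1 ?addr0.
  case: (eqVneq j k) => [<- _|_]; first by rewrite M0 N0 mulr0 mul0r.
  by rewrite add0r -mulrA => ->; rewrite mulrA (mulrC (de j)) alde mul1r.
by move=> l lj; rewrite eq_sym (negPf lj) ga0 mulr0 addr0 mul0r.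
Qed.

(* Local complementation at v acts on the symplectic at v by a shear that can
   cancel [ga v] when [al v != 0], and leaves the other [ga] unchanged; if [al]
   vanishes wherever [ga] does not, a local complementation at a neighbour first
   makes some [al v] nonzero. *)
Lemma local_symplectic_reach M N al be ga de :
  label_matrix M -> label_matrix N -> local_symplectic M N al be ga de ->
  graph_reach M N.
Proof.
have [m] := ubnP #|[set i | ga i != 0]|.
elim: m => // m IHm in M al be ga de *.
have good M' al' be' ga' de' v : (#|[set i | (ga' i != 0)%R]| < m.+1)%N ->
    label_matrix M' -> label_matrix N -> local_symplectic M' N al' be' ga' de' ->
    ga' v != 0 -> al' v != 0 -> graph_reach M' N.
  move=> cardm lM lN ls gv av.
  (* This parameter solves [ga' v - s * al' v = 0]. *)
  have ls' := local_symplectic_star v (ga' v / al' v) lM ls.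
  apply: (rt_trans _ _ _ (star_op M' v (- (ga' v / al' v)))).
    by apply: rt_step; exists v; right; eexists.
  apply: (IHm _ _ _ _ _ _ (star_label_matrix _ _ lM) lN ls').
  rewrite ltnS in cardm; apply: leq_trans cardm; apply: proper_card; apply/properP; split.
    apply/subsetP=> k; rewrite !inE; case: (eqVneq k v) => [-> //|_].
    by rewrite mulr0n subr0.
  by exists v; rewrite inE ?gv // eqxx mulr1n divfK // subrr eqxx.
move=> cardm lM lN ls.
have [/existsP[v /andP[gv av]]|noal] := boolP [exists v, (ga v != 0) && (al v != 0)].
  exact: (good _ _ _ _ _ v cardm lM lN ls).
have [/existsP[v gv]|noga] := boolP [exists v, ga v != 0]; last first.
  apply: (local_symplectic_reach_free lM lN ls) => i.
  by apply/eqP; apply: contraR noga => gi; apply/existsP; exists i.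
have al0 i : ga i != 0 -> al i = 0.
  move=> gi; apply/eqP; apply: contraR noal => ai.
  by apply/existsP; exists i; rewrite gi.
have M0 i : M i i = 0 by case: lM.
(* Complementing at such a [w] turns [al v = 0] into [- M w v ^+ 2 * ga v], which is nonzero, and
   keeps every [ga] because [al w = 0]. *)
have [/existsP[w /andP[gw Mw]]|noM] := boolP [exists w, (ga w != 0) && (M v w != 0)].
  have ls' := local_symplectic_star w 1 lM ls.
  apply: (rt_trans _ _ _ (star_op M w (- 1))).
    by apply: rt_step; exists w; right; eexists.
  apply: (good _ _ _ _ _ v _ _ lN ls'); last 1 first.
  - rewrite (al0 _ gv) mul1r sub0r oppr_eq0 mulf_neq0 // expf_neq0 //.
    by rewrite (label_matrix_sym lM).
  - apply: leq_ltn_trans cardm; apply: subset_leq_card; apply/subsetP=> k.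
    by rewrite !inE; case: (eqVneq k w) => [-> //|_]; rewrite mulr0n subr0.
  - exact: star_label_matrix.
  - by case: (eqVneq v w) gv => [->|_] gv; rewrite ?(al0 _ gw) ?mulr0 ?mul0rn ?mulr0n subr0.
(* Without such a neighbour, row [v] of the X-part vanishes. The equation at [(v, v)] then gives
   [be v = 0], which with [al v = 0] contradicts determinant 1. *)
case: ls => det1 eqAB; have := det1 v; have := eqAB v v.
rewrite eqxx M0 mul0r addr0 (al0 _ gv) big1 ?mulr1n => [->|l _].
  by rewrite !mul0r subr0 => /eqP; rewrite eq_sym oner_eq0.
rewrite mul0rn add0r; have [->|gl] := eqVneq (ga l) 0; first by rewrite mulr0 mul0r.
have [->|Ml] := eqVneq (M v l) 0; first by rewrite !mul0r.
by case/negP: noM; apply/existsP; exists l; rewrite gl.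
Qed.

End LocalSymplectic.

(** * Operators *)

Section Operators.
Variable T : finType.
Implicit Types (A B C : op T) (psi phi : T -> CC).

Lemma op_eqP A B : op_eq A B -> A = B.
Proof. by move=> eqAB; do 2!apply: functional_extensionality => ?; apply: eqAB. Qed.

Lemma opmulA A B C : opmul A (opmul B C) = opmul (opmul A B) C.
Proof.
apply: op_eqP => y x; rewrite /opmul.
under eq_bigr => z _ do rewrite mulr_sumr.
rewrite exchange_big /=; apply: eq_bigr => z _; rewrite mulr_suml.
by apply: eq_bigr => w _; rewrite mulrA.
Qed.

Lemma opmul1 A : opmul A (@opid T) = A.
Proof.
apply: op_eqP => y x; rewrite /opmul /opid (bigD1 x) //= eqxx mulr1.
by rewrite big1 ?addr0 // => z /negPf ->; rewrite mulr0.
Qed.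

Lemma opadjM A B : opadj (opmul A B) = opmul (opadj B) (opadj A).
Proof.
apply: op_eqP => y x; rewrite /opadj /opmul rmorph_sum /=.
by apply: eq_bigr => z _; rewrite rmorphM mulrC.
Qed.

Lemma opapply_mul A B psi : opapply A (opapply B psi) =1 opapply (opmul A B) psi.
Proof.
move=> y; rewrite /opapply /opmul.
under eq_bigr => z _ do rewrite mulr_sumr.
rewrite exchange_big /=; apply: eq_bigr => z _; rewrite mulr_suml.
by apply: eq_bigr => w _; rewrite mulrA.
Qed.

Lemma eq_opapply A psi phi : psi =1 phi -> opapply A psi =1 opapply A phi.
Proof. by move=> eq_psi y; apply: eq_bigr => x _; rewrite eq_psi. Qed.

Lemma opapplyZ A (lam : CC) psi y :
  opapply A (fun x => lam * psi x) y = lam * opapply A psi y.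
Proof. by rewrite /opapply mulr_sumr; apply: eq_bigr => x _; rewrite mulrCA. Qed.

End Operators.

(** In finite dimension a right inverse is a left inverse; this is transferred from square
    matrices. *)
Lemma unitary_adjl p (h : op 'F_p) : unitary h -> opmul (opadj h) h = @opid 'F_p.
Proof.
pose mx (A : op 'F_p) : 'M[CC]_((Zp_trunc (pdiv p)).+2) := \matrix_(i, j) A i j.
have mxM A B : mx (opmul A B) = mx A *m mx B.
  by apply/matrixP=> i j; rewrite !mxE; apply: eq_bigr => k _; rewrite !mxE.
have mx1 : mx (@opid 'F_p) = 1%:M by apply/matrixP=> i j; rewrite !mxE.
move=> /op_eqP hU; apply: op_eqP => y x.
have /mulmx1C : mx h *m mx (opadj h) = 1%:M by rewrite -mxM hU.
by rewrite -mxM -mx1 => /matrixP/(_ y x); rewrite !mxE.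
Qed.

(** * The additive character of F_p *)

Section Qupits.
Variable p : nat.
Hypotheses (p_prime : prime p) (p_odd : odd p).

Lemma omega_expr k (t := 2 * Rtrigo1.PI / p%:R) :
  omega p ^+ k = Complex (Rtrigo_def.cos (k%:R * t)) (Rtrigo_def.sin (k%:R * t)).
Proof.
elim: k => [|k IHk]; first by rewrite mul0r Rtrigo_def.cos_0 Rtrigo_def.sin_0.
rewrite exprSr IHk /omega -/t -natr1 mulrDl mul1r Cos_plus.cos_plus Rtrigo1.sin_plus.
by congr Complex; rewrite addrC.
Qed.

Lemma omega_expr_order : omega p ^+ p = 1.
Proof.
rewrite omega_expr mulrC divfK ?pnatr_eq0 -?lt0n ?prime_gt0 //.
rewrite mulr_natl mulr2n Cos_plus.cos_plus Rtrigo1.sin_plus.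
have -> : Rtrigo_def.cos Rtrigo1.PI = - 1 by exact: Rtrigo1.cos_PI.
rewrite Rtrigo1.sin_PI; apply/eqP; rewrite eq_complex /=.
by rewrite !RmultE RminusE RplusE !mulr0 mul0r subr0 addr0 mulrNN mulr1 !eqxx.
Qed.

(** Since [2 < p], the angle lies strictly between 0 and pi, so the imaginary part is positive. *)
Lemma omega_neq1 : omega p != 1.
Proof.
have p2 : (2 < p)%N by rewrite odd_prime_gt2.
have p0 : 0 < p%:R :> Rdefinitions.R by rewrite ltr0n ltnW // ltnW.
have PI0 : 0 < Rtrigo1.PI by apply/RltP; exact: Rtrigo1.PI_RGT_0.
rewrite eq_complex negb_and /=; apply/orP; right; apply: lt0r_neq0.
apply/RltP/Rtrigo1.sin_gt_0; apply/RltP; first by rewrite divr_gt0 // mulr_gt0.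
by rewrite ltr_pdivrMr // mulrC ltr_pM2l // ltr_nat.
Qed.

Lemma omega_prim : p.-primitive_root (omega p).
Proof.
have [m] := prim_order_exists (prime_gt0 p_prime) omega_expr_order.
move=> prim_m m_dvd; suff m1 : m != 1%N.
  by move: prim_m; rewrite (prime_nt_dvdP p_prime m1 m_dvd).
by apply: contraNneq omega_neq1 => m1; move: (prim_expr_order prim_m); rewrite m1 expr1 => ->.
Qed.

Definition chi (x : 'F_p) : CC := omega p ^+ x.

Lemma chi0 : chi 0 = 1. Proof. by []. Qed.

Lemma chiD x y : chi (x + y) = chi x * chi y.
Proof.
rewrite /chi -exprD -(prim_expr_mod omega_prim (x + y)%N) /=.
by congr (_ ^+ (_ %% _)); rewrite Fp_cast.
Qed.

Lemma chi_sum (I : finType) (F : I -> 'F_p) : chi (\sum_i F i) = \prod_i chi (F i).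
Proof. exact: (big_morph chi chiD chi0). Qed.

Lemma chiVr x : chi (- x) * chi x = 1. Proof. by rewrite -chiD addNr. Qed.

Lemma chi_neq0 x : chi x != 0.
Proof. by apply: contra_eq_neq (chiVr x) => ->; rewrite mulr0 eq_sym oner_neq0. Qed.

Lemma chi_inj : injective chi.
Proof.
move=> x y /eqP; rewrite /chi (eq_prim_root_expr omega_prim) => /eqP.
have ltp (z : 'F_p) : (z < p)%N by rewrite -{2}(Fp_cast p_prime).
by rewrite !modn_small // => /val_inj.
Qed.

Lemma conj_chi x : (chi x)^* = chi (- x).
Proof.
apply: (mulIf (chi_neq0 x)); rewrite chiVr mulrC -normCK.
suff -> : `|chi x| = 1 by rewrite expr1n.
apply/eqP; rewrite -(@pexpr_eq1 _ _ p) ?prime_gt0 // -normrX /chi exprAC.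
by rewrite omega_expr_order expr1n normr1.
Qed.

Lemma sum_chi a : \sum_u chi (a * u) = (p%:R : CC) *+ (a == 0).
Proof.
have [->|a0] := eqVneq a 0.
  under eq_bigr => u _ do rewrite mul0r chi0.
  by rewrite sumr_const card_ord Fp_cast.
(* Translating the summation variable by 1 multiplies the sum by [chi a], which is not 1. *)
apply/eqP; set S := \sum_u _; have : S = chi a * S.
  rewrite /S [LHS](reindex_inj (addrI 1)) mulr_sumr; apply: eq_bigr => u _.
  by rewrite -chiD mulrDr mulr1.
move/eqP; rewrite -subr_eq0 -{1}[S]mul1r -mulrBl mulf_eq0 => /orP[|//].
by rewrite subr_eq0 eq_sym -chi0 (inj_eq chi_inj) (negPf a0).
Qed.

(** * Clifford operators *)

Implicit Types (h : op 'F_p) (a b c : 'F_p).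

Lemma two_neq0 : 2 != 0 :> 'F_p.
Proof.
rewrite -(dvdn_pcharf (pchar_Fp p_prime)); apply/negP => /(@dvdn_leq _ 2 isT).
by rewrite leqNgt odd_prime_gt2.
Qed.

Lemma XZ_entry a b (y x : 'F_p) :
  opmul (Xop a) (Zop b) y x = (x == y - a)%:R * chi (b * (y - a)).
Proof.
rewrite /opmul /Xop /Zop (bigD1 x) //= eqxx mul1r big1 ?addr0.
  by rewrite -subr_eq eq_sym; case: eqP => [->|] //; rewrite !mul0r.
by move=> z /negPf ->; rewrite mul0r mulr0.
Qed.

Lemma opmul_pauli h c a b (y x : 'F_p) :
  opmul h (pauli1 c a b) y x = chi c * (h y (x + a) * chi (b * x)).
Proof.
rewrite {1}/opmul (bigD1 (x + a)) //= /pauli1 /opscale XZ_entry addrK eqxx mul1r.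
rewrite big1 ?addr0 => [|z za]; first by rewrite mulrCA.
by rewrite XZ_entry eq_sym subr_eq (negPf za) mul0r !mulr0.
Qed.

Lemma pauli_opmul h c a b (y x : 'F_p) :
  opmul (pauli1 c a b) h y x = chi c * (chi (b * (y - a)) * h (y - a) x).
Proof.
rewrite {1}/opmul (bigD1 (y - a)) //= /pauli1 /opscale XZ_entry eqxx mul1r.
rewrite big1 ?addr0 => [|z za]; first by rewrite mulrA.
by rewrite XZ_entry (negPf za) mul0r mulr0 mul0r.
Qed.

(** Entrywise form of [h X(a)Z(b) = const X(a')Z(b') h]. The scalar [c] absorbs all phases, so that
    only the action on exponents is tracked. *)
Definition intertwines h a b a' b' : Prop :=
  exists2 c, c != 0 &
    forall y x, h y (x + a) * chi (b * x) = c * chi (b' * y) * h (y - a') x.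

Lemma clifford_intertwines h a b :
  clifford h -> exists a' b', intertwines h a b a' b'.
Proof.
case=> hU /(_ 0 a b)[c' [a' [b' /op_eqP hP]]]; exists a', b'.
have {}hP : opmul h (pauli1 0 a b) = opmul (pauli1 c' a' b') h.
  by rewrite -hP -!opmulA (unitary_adjl hU) opmul1.
exists (chi c' * chi (- (b' * a'))) => [|y x]; first by rewrite mulf_neq0 ?chi_neq0.
have := congr1 (fun A : op 'F_p => A y x) hP.
rewrite opmul_pauli pauli_opmul mul1r => ->.
by rewrite !mulrA -!chiD; congr (chi _ * _); ring.
Qed.

Lemma clifford_of_intertwining h : unitary h ->
  (forall a b, exists c' a' b', forall y x,
     h y (x + a) * chi (b * x) = chi (c' + b' * (y - a')) * h (y - a') x) ->
  clifford h.
Proof.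
move=> hU hI; split=> // c a b; have [c' [a' [b' hE]]] := hI a b.
exists (c + c'), a', b'.
suff -> : opmul h (pauli1 c a b) = opmul (pauli1 (c + c') a' b') h.
  by rewrite -opmulA (op_eqP hU) opmul1.
by apply: op_eqP => y x; rewrite opmul_pauli pauli_opmul hE !chiD !mulrA.
Qed.

Lemma clifford_mul g h : clifford g -> clifford h -> clifford (opmul g h).
Proof.
move=> [/op_eqP gU gP] [/op_eqP hU hP]; split=> [|c a b].
  by rewrite /unitary opadjM opmulA -(opmulA g) hU opmul1 gU.
have [c1 [a1 [b1 /op_eqP hE]]] := hP c a b.
have [c2 [a2 [b2 /op_eqP gE]]] := gP c1 a1 b1; exists c2, a2, b2.
by rewrite -gE -hE opadjM !opmulA.
Qed.

Lemma intertwinesD h a b a' b' c d c' d' :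
  intertwines h a b a' b' -> intertwines h c d c' d' ->
  intertwines h (a + c) (b + d) (a' + c') (b' + d').
Proof.
move=> [u u0 hu] [v v0 hv].
(* The phase [b * c] comes from moving [Z(b)] past [X(c)], and [d' * a'] from evaluating the second
   relation at [y - a']. *)
exists (u * v * chi (- (d' * a' + b * c))) => [|y x]; first by rewrite !mulf_neq0 ?chi_neq0.
have -> : h y (x + (a + c)) * chi ((b + d) * x) =
    h y (x + c + a) * chi (b * (x + c)) * chi (d * x) * chi (- (b * c)).
  rewrite -addrA (addrC c a) -!mulrA -!chiD; congr (_ * chi _); ring.
have E : chi (- (d' * a' + b * c)) * chi ((b' + d') * y) =
    chi (b' * y) * chi (- (b * c)) * chi (d' * (y - a')).
  by rewrite -!chiD; congr chi; ring.
rewrite hu -[u * v * _ * _]mulrA E.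
have -> : u * chi (b' * y) * h (y - a') (x + c) * chi (d * x) * chi (- (b * c)) =
    u * chi (b' * y) * chi (- (b * c)) * (h (y - a') (x + c) * chi (d * x)) by ring.
by rewrite hv opprD addrA; ring.
Qed.

Lemma intertwinesM h a b a' b' k :
  intertwines h a b a' b' -> intertwines h (k * a) (k * b) (k * a') (k * b').
Proof.
move=> hI; rewrite -(natr_Zp k); elim: (k : nat) => [|m IHm].
  by exists 1 => [|y x]; rewrite ?oner_neq0 // !mul0r subr0 addr0 mulr1 !mul1r.
by rewrite -natr1 !mulrDl !mul1r; apply: intertwinesD.
Qed.

(** The pairs [(al, be)] and [(ga, de)] are the images of [X(1)] and [Z(1)]; additivity extends them
    linearly. Conjugation preserves the commutation phase of [X(1)] and [Z(1)], which forces
    determinant 1. *)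
Lemma clifford_symplectic h : clifford h -> exists al be ga de,
  al * de - be * ga = 1 /\
  forall a b, intertwines h a b (a * al + b * ga) (a * be + b * de).
Proof.
move=> hC; have [al [be hX]] := clifford_intertwines 1 0 hC.
have [ga [de hZ]] := clifford_intertwines 0 1 hC.
exists al, be, ga, de; split; last first.
  move=> a b; have := intertwinesD (intertwinesM a hX) (intertwinesM b hZ).
  by rewrite !mulr1 !mulr0 addr0 add0r.
have [u u0 hu] := hX; have [v v0 hv] := hZ.
(* A nonzero entry, to be cancelled when the two orders [XZ] and [ZX] are compared; unitarity
   provides one in row 0. *)
have [y [x h0]] : exists y x, h (y - al - ga) x != 0.
  have := op_eqP hC.1 => /(congr1 (fun A : op 'F_p => A 0 0)); rewrite /opmul /opid eqxx.
  have [/existsP[x hx] _|/existsPn hx] := boolP [exists x, h 0 x != 0].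
    by exists (ga + al), x; rewrite -addrA -opprD (addrC al) subrr.
  rewrite big1 => [/eqP|x _]; first by rewrite eq_sym oner_eq0.
  by move: (hx x); rewrite negbK => /eqP ->; rewrite mul0r.
have XZ : h y (x + 1) * chi x =
    u * v * chi (be * y + de * (y - al)) * h (y - al - ga) x.
  have := hu y x; rewrite mul0r chi0 mulr1 => ->.
  have := hv (y - al) x; rewrite addr0 mul1r -[X in _ -> X = _]mulrA => ->.
  by rewrite chiD; ring.
have ZX : h y (x + 1) * chi (x + 1) =
    u * v * chi (de * y + be * (y - ga)) * h (y - al - ga) x.
  have := hv y (x + 1); rewrite addr0 mul1r => ->.
  have := hu (y - ga) x; rewrite mul0r chi0 mulr1 => ->.
  by rewrite chiD addrAC; ring.
move: ZX; rewrite chiD mulrA XZ mulrAC => /(mulIf h0).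
rewrite -!mulrA => /(mulfI u0)/(mulfI v0); rewrite -chiD => /chi_inj eqs.
apply/eqP; rewrite -subr_eq0; move/eqP: eqs; rewrite eq_sym -subr_eq0 => /eqP <-.
by apply/eqP; ring.
Qed.

(** * Explicit Clifford operators: substitutions with quadratic phases, and Gaussian convolutions *)

Definition monomial_op (f t d : 'F_p) : op 'F_p :=
  fun y x => (x == f * y)%:R * chi (t * y ^+ 2 + d * y).

Lemma clifford_monomial f t d : f != 0 -> clifford (monomial_op f t d).
Proof.
move=> f0; apply: clifford_of_intertwining => [y x|a b].
  rewrite /opmul /opadj /monomial_op (bigD1 (f * y)) //= eqxx mul1r big1 ?addr0.
    rewrite rmorphM /= rmorph_nat conj_chi /opid (inj_eq (mulfI f0)).
    by case: eqP => [->|_]; rewrite ?mul0r ?mulr0 // mul1r -chiD subrr.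
  by move=> z /negPf ->; rewrite !mul0r.
(* Matching the delta functions gives [a'], the coefficient of [y] in the phase gives [b'], and the
   constant term gives [c']. *)
pose a' := a / f; pose b' := b * f + 2 * t * a'.
exists (- b * a + b' * a' - t * a' ^+ 2 + d * a'), a', b' => y x; rewrite /monomial_op.
have fa : f * a' = a by rewrite mulrCA divff ?mulr1.
have -> : (x == f * (y - a')) = (x + a == f * y).
  by rewrite mulrBr fa eq_sym subr_eq eq_sym.
case: eqP => [xa|_]; last by rewrite !mul0r mulr0.
have -> : x = f * y - a by rewrite -xa addrK.
by rewrite !mul1r -!chiD; congr chi; rewrite -fa /b'; ring.
Qed.

Definition conv_op (s : 'F_p) : op 'F_p :=
  fun y x => (sqrtC p%:R)^-1 * chi (s * (y - x) ^+ 2).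

(** In the product with the adjoint the squares of the summation variable cancel, leaving a
    character sum that vanishes off the diagonal. *)
Lemma clifford_conv s : s != 0 -> clifford (conv_op s).
Proof.
move=> s0; have t0 := two_neq0; have st0 : 2 * s != 0 by rewrite mulf_neq0.
have P0 : (p%:R : CC) != 0 by rewrite pnatr_eq0 -lt0n prime_gt0.
apply: clifford_of_intertwining => [y x|a b]; last first.
  (* Chosen so that [2 * s * (a' - a) = b]: the difference of the two squares then contributes
     [b * (y - x)], which turns [b * x] into [b * y]. *)
  pose a' := a + b / (2 * s).
  exists (s * (a ^+ 2 - a' ^+ 2) + b * a'), a', b => y x; rewrite /conv_op.
  rewrite -mulrA -chiD [RHS]mulrCA -chiD; congr (_ * chi _).
  have -> : b = 2 * s * (a' - a) by rewrite /a' addrAC subrr add0r mulrC divfK.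
  ring.
rewrite /opmul /opadj /opid.
have cr : ((sqrtC p%:R)^-1)^* = (sqrtC p%:R)^-1 :> CC.
  by apply: geC0_conj; rewrite invr_ge0 sqrtC_ge0 ler0n.
transitivity (p%:R^-1 * chi (s * (y ^+ 2 - x ^+ 2)) *
    \sum_u chi (2 * s * (x - y) * u)).
  rewrite mulr_sumr; apply: eq_bigr => u _; rewrite /conv_op rmorphM /= cr conj_chi.
  rewrite mulrACA -invfM -expr2 sqrtCK -chiD -mulrA -chiD; congr (_ * chi _); ring.
rewrite sum_chi mulf_eq0 (negPf st0) /= subr_eq0 eq_sym.
case: eqP => [->|_]; last by rewrite mulr0.
by rewrite subrr mulr0 chi0 mulr1 mulVf.
Qed.

(** * Graph states *)

Variable n : nat.
Implicit Types (M N : 'M['F_p]_n) (y x z : basis_n p n) (psi phi : basis_n p n -> CC).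
Implicit Types (d e f : 'I_n -> 'F_p).

Lemma tensorop_mul (gs hs : 'I_n -> op 'F_p) :
  opmul (tensorop gs) (tensorop hs) = tensorop (fun i => opmul (gs i) (hs i)).
Proof.
apply: op_eqP => y x; rewrite /opmul /tensorop bigA_distr_bigA /=.
by apply: eq_bigr => z _; rewrite big_split.
Qed.

(** The tensor product of the adjoints is a left inverse. This serves to exclude a zero scalar in
    [LC_equiv]. *)
Lemma opapply_unitary0 (hs : 'I_n -> op 'F_p) psi :
  (forall i, unitary (hs i)) -> opapply (tensorop hs) psi =1 (fun=> 0) ->
  psi =1 (fun=> 0).
Proof.
move=> hU h0 x.
have := opapply_mul (tensorop (fun i => opadj (hs i))) (tensorop hs) psi x.
rewrite {1}/opapply big1 => [|z _]; last by rewrite h0 mulr0.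
rewrite tensorop_mul /opapply (bigD1 x) //= /tensorop.
have hE i := unitary_adjl (hU i).
rewrite [X in X * _]big1 => [|i _]; last by rewrite hE /opid eqxx.
rewrite mul1r big1 ?addr0 // => z zx.
have [i zi] : exists i, x i != z i.
  apply/existsP; apply: contraR zx => /existsPn eqz.
  by apply/eqP/ffunP => i; move: (eqz i); rewrite negbK => /eqP.
by rewrite (bigD1 i) //= hE /opid (negPf zi) !mul0r.
Qed.

Lemma LC_equiv_trans psi phi xi : LC_equiv psi phi -> LC_equiv phi xi -> LC_equiv psi xi.
Proof.
move=> [hs [hC [lam hE]]] [gs [gC [mu gE]]].
exists (fun i => opmul (gs i) (hs i)); split=> [i|]; first exact: clifford_mul.
exists (lam * mu) => y; rewrite -tensorop_mul -opapply_mul (eq_opapply _ hE).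
by rewrite opapplyZ gE mulrA.
Qed.

(** Each row of each factor has its only possible nonzero entry in column [g i t], so one term of
    the sum survives. This covers both Pauli operators and [monomial_op]. *)
Lemma opapply_monomial (g : 'I_n -> 'F_p -> 'F_p) (w : 'I_n -> 'F_p -> CC) psi y :
  opapply (tensorop (fun i (t u : 'F_p) => (u == g i t)%:R * w i t)) psi y =
  (\prod_i w i (y i)) * psi [ffun i => g i (y i)].
Proof.
rewrite /opapply (bigD1 [ffun i => g i (y i)]) //= big1 ?addr0 => [|z zg].
  by congr (_ * _); apply: eq_bigr => i _; rewrite ffunE eqxx mul1r.
have [i zi] : exists i, z i != g i (y i).
  apply/existsP; apply: contraR zg => /existsPn eqz.
  by apply/eqP/ffunP => i; move: (eqz i); rewrite negbK ffunE => /eqP.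
by rewrite /tensorop (bigD1 i) //= (negPf zi) !mul0r.
Qed.

(** * Graph states as quadratic phases *)

Definition quad M y : 'F_p := 2^-1 * \sum_i \sum_j M i j * y i * y j.

Definition gstate M d y : CC := chi (quad M y + \sum_j d j * y j).

Lemma gstate_neq0 M d y : gstate M d y != 0.
Proof. exact: chi_neq0. Qed.

(** Polarization: by symmetry the two cross terms agree, and their sum absorbs the factor [2^-1]. *)
Lemma quadD M y z : (forall i j, M i j = M j i) ->
  quad M (y + z) = quad M y + quad M z + \sum_i z i * \sum_j M i j * y j.
Proof.
move=> sM; rewrite /quad; set S := \sum_i z i * _.
have -> : \sum_i \sum_j M i j * (y + z) i * (y + z) j =
  \sum_i \sum_j M i j * y i * y j + \sum_i \sum_j M i j * z i * z j + 2 * S.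
  have SE : S = \sum_i \sum_j M i j * z i * y j.
    apply: eq_bigr => i _; rewrite mulr_sumr; apply: eq_bigr => j _.
    by rewrite mulrCA mulrA.
  have SE' : S = \sum_i \sum_j M i j * y i * z j.
    rewrite SE exchange_big; apply: eq_bigr => i _; apply: eq_bigr => j _ /=.
    by rewrite sM mulrAC.
  rewrite mulr_natl mulr2n {1}SE SE' -!big_split /=; apply: eq_bigr => i _.
  rewrite -!big_split /=; apply: eq_bigr => j _; rewrite !ffunE; ring.
by rewrite !mulrDr mulrA mulVf ?two_neq0 // mul1r.
Qed.

Lemma gstateD M d y z : (forall i j, M i j = M j i) ->
  gstate M d (y + z) =
  gstate M d z * gstate M d y * chi (\sum_i z i * \sum_j M i j * y j).
Proof.
move=> sM; rewrite /gstate quadD // -!chiD; congr chi.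
have -> : \sum_j d j * (y + z) j = \sum_j d j * y j + \sum_j d j * z j.
  by rewrite -big_split; apply: eq_bigr => j _; rewrite ffunE mulrDr.
ring.
Qed.

Lemma sum_unit_vec (F : 'I_n -> 'F_p) v (k : 'F_p) :
  \sum_i (unit_vec p v i * k) * F i = k * F v.
Proof.
rewrite (bigD1 v) //= ffunE eqxx mul1r big1 ?addr0 // => i /negPf iv.
by rewrite ffunE iv !mul0r.
Qed.

Lemma sum_unit_vec1 (F : 'I_n -> 'F_p) v : \sum_i unit_vec p v i * F i = F v.
Proof.
by rewrite -[RHS]mul1r -sum_unit_vec; apply: eq_bigr => i _; rewrite mulr1.
Qed.

Lemma sum_unit_vecr (F : 'I_n -> 'F_p) v : \sum_i F i * unit_vec p v i = F v.
Proof. by rewrite -[RHS]sum_unit_vec1; apply: eq_bigr => i _; rewrite mulrC. Qed.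

Lemma graph_gen_apply M (c : 'I_n -> 'F_p) i psi y :
  opapply (graph_gen M c i) psi y =
  chi (c i) * (chi (\sum_j M i j * (y j - unit_vec p i j)) * psi (y - unit_vec p i)).
Proof.
rewrite /graph_gen /Xn /Zn tensorop_mul.
have -> : opapply (opscale (omega p ^+ c i) (tensorop
    (fun j => opmul (Xop (unit_vec p i j)) (Zop (row_vec M i j))))) psi y =
  chi (c i) * opapply (tensorop (fun j (y x : 'F_p) => (x == y - unit_vec p i j)%:R *
     chi (M i j * (y - unit_vec p i j)))) psi y.
  rewrite /opapply mulr_sumr; apply: eq_bigr => x _; rewrite /opscale -mulrA.
  congr (chi (c i) * (_ * psi x)); apply: eq_bigr => j _.
  by rewrite XZ_entry [row_vec _ _ _]ffunE.
rewrite (opapply_monomial (fun j t => t - unit_vec p i j)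
  (fun j t => chi (M i j * (t - unit_vec p i j)))) chi_sum.
by congr (_ * (_ * psi _)); apply/ffunP=> j; rewrite !ffunE.
Qed.

(** The generator phases [c] serve as linear part: [psi] and [gstate M c] gain the same factor under
    translation by each basis vector. Their ratio is therefore invariant under all translations,
    hence constant. *)
Lemma graph_stateE M psi : label_matrix M -> graph_state M psi ->
  exists lam d, lam != 0 /\ forall y, psi y = lam * gstate M d y.
Proof.
move=> lM [[x0 psi0] [c psiE]]; have sM := label_matrix_sym lM.
have M0 i : M i i = 0 by case: lM.
pose r y := psi y / gstate M c y.
have g0 := gstate_neq0 M c.
have psir y : psi y = r y * gstate M c y by rewrite /r divfK.
have shift i y : r (unit_vec p i + y) = r y.
  apply: (mulIf (g0 (unit_vec p i + y))); rewrite -psir -(psiE i) graph_gen_apply.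
  rewrite addrAC subrr add0r psir addrC gstateD // sum_unit_vec1.
  have -> : \sum_j M i j * ((y + unit_vec p i) j - unit_vec p i j) =
    \sum_j M i j * y j by apply: eq_bigr => j _; rewrite ffunE addrK.
  have -> : gstate M c (unit_vec p i) = chi (c i).
    congr chi; rewrite /quad.
    have -> : \sum_k \sum_j M k j * unit_vec p i k * unit_vec p i j =
      \sum_k unit_vec p i k * \sum_j unit_vec p i j * M k j.
      apply: eq_bigr => k _; rewrite mulr_sumr; apply: eq_bigr => j _.
      ring.
    rewrite 2!sum_unit_vec1 M0 mulr0 add0r.
    by rewrite sum_unit_vecr.
  ring.
have shiftn i k y : r (unit_vec p i *+ k + y) = r y.
  by elim: k => [|k IHk]; rewrite ?mulr0n ?add0r // mulrS -addrA shift.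
have rE y : r y = r 0.
  have -> : y = \sum_i unit_vec p i *+ (y i : nat).
    apply/ffunP=> j; rewrite sum_ffunE (bigD1 j) //= big1 ?addr0 => [|i /negPf ij].
      by rewrite ffunMnE ffunE eqxx natr_Zp.
    by rewrite ffunMnE ffunE eq_sym ij mul0rn.
  by elim/big_rec: _ => // i z _ <-; exact: shiftn.
exists (r 0), c; split=> [|y]; last by rewrite psir rE.
by apply: contraNneq psi0 => r0; rewrite psir rE r0 mul0r.
Qed.

(** The quadratic phase [t i] corrects the diagonal and the linear phase [u i] the vector [d], so
    only off-diagonal entries need to match. *)
Lemma LC_equiv_monomial M N f d e : (forall i, f i != 0) ->
  (forall i j, i != j -> N i j = f i * M i j * f j) ->
  LC_equiv (gstate M d) (gstate N e).
Proof.
move=> f0 NE; pose t i := 2^-1 * (N i i - f i * M i i * f i).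
pose u i := e i - d i * f i.
exists (fun i => monomial_op (f i) (t i) (u i)).
split=> [i|]; first exact: clifford_monomial.
exists 1 => y; rewrite mul1r (opapply_monomial (fun i s => f i * s)
  (fun i s => chi (t i * s ^+ 2 + u i * s))) -chi_sum /gstate -chiD; congr chi.
rewrite addrA /quad !mulr_sumr -!big_split /=; apply: eq_bigr => i _.
rewrite (bigD1 i) // [in RHS](bigD1 i) //= !ffunE.
have -> : \sum_(j | j != i) M i j * (f i * y i) *
    [ffun i => f i * y i] j = \sum_(j | j != i) N i j * y i * y j.
  by apply: eq_bigr => j ji; rewrite ffunE NE 1?eq_sym //; ring.
by rewrite /t /u; ring.
Qed.

(** * Realizing the graph operations by local Clifford operators *)

Definition at_site (v : 'I_n) (h : op 'F_p) (j : 'I_n) : op 'F_p :=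
  if j == v then h else monomial_op 1 0 0.

Definition site_vec (v : 'I_n) (u : 'F_p) : basis_n p n := [ffun j => unit_vec p v j * u].

Lemma opapply_at_site v h psi y :
  opapply (tensorop (at_site v h)) psi y =
  \sum_u h (y v) (y v + u) * psi (y + site_vec v u).
Proof.
have vE : site_vec v = fun u => [ffun j => u *+ (j == v)].
  by apply: functional_extensionality => u; apply/ffunP=> j; rewrite !ffunE mulr_natl.
rewrite /opapply vE.
(* Only the [x] agreeing with [y] away from [v] contribute; they are parametrized by
   [u = x v - y v]. *)
rewrite (bigID (fun x => [forall j, (j != v) ==> (x j == y j)])) /= [X in _ + X]big1 ?addr0.
  rewrite (reindex_onto (fun u => y + [ffun j => u *+ (j == v)]) (fun x => x v - y v)) /=.
    apply: eq_big => [u|u _].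
      rewrite !ffunE eqxx mulr1n addrAC subrr add0r eqxx andbT.
      by apply/forallP=> j; apply/implyP => /negPf jv; rewrite !ffunE jv addr0.
    congr (_ * _); rewrite /tensorop (bigD1 v) //= /at_site eqxx !ffunE eqxx mulr1n.
    rewrite big1 ?mulr1 // => j /negPf jv.
    by rewrite jv /monomial_op !ffunE jv addr0 mul1r eqxx !mul0r addr0 mulr1.
  move=> x /forallP xy; apply/ffunP=> j; rewrite !ffunE.
  have [->|jv] := eqVneq j v; first by rewrite mulr1n addrC subrK.
  by have /implyP/(_ jv)/eqP -> := xy j; rewrite addr0.
move=> x; rewrite negb_forall => /existsP[j]; rewrite negb_imply => /andP[jv xj].
by rewrite /tensorop (bigD1 j) //= /at_site (negPf jv) /monomial_op mul1r (negPf xj) !mul0r.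
Qed.

(** With [L] the linear form [M v . y + d v], the summand has phase
    [s u^2 + u L = s (u - a L)^2 + a L^2 / 2]. The last term adds [a * M v j * M v k] to the matrix,
    and its cross term shifts [d]. *)
Lemma LC_equiv_conv M v (a : 'F_p) d : label_matrix M -> a != 0 ->
  LC_equiv (gstate M d)
    (gstate (\matrix_(j, k) (M j k + a * M v j * M v k)) (fun j => d j + a * d v * M v j)).
Proof.
move=> lM a0; have sM := label_matrix_sym lM; have M0 i : M i i = 0 by case: lM.
pose s := - (2 * a)^-1; have a20 : 2 * a != 0 by rewrite mulf_neq0 ?two_neq0.
have as1 : s * (2 * a) = -1 by rewrite mulNr mulVf.
have s0 : s != 0 by rewrite oppr_eq0 invr_eq0.
exists (at_site v (conv_op s)); split=> [i|].
  rewrite /at_site; case: ifP => _; first exact: clifford_conv.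
  by apply: clifford_monomial; apply: oner_neq0.
pose K := \sum_u chi (s * u ^+ 2); pose r : CC := (sqrtC p%:R)^-1.
exists (r * K * chi (2^-1 * a * d v ^+ 2)) => y; rewrite opapply_at_site.
pose L0 := \sum_j M v j * y j; pose L := L0 + d v.
have gv u : gstate M d (site_vec v u) = chi (d v * u).
  congr chi; rewrite /quad.
  have -> : \sum_i \sum_j M i j * site_vec v u i * site_vec v u j =
    \sum_i (unit_vec p v i * u) * \sum_j (unit_vec p v j * u) * M i j.
    apply: eq_bigr => i _; rewrite mulr_sumr; apply: eq_bigr => j _.
    rewrite [site_vec v u i]ffunE [site_vec v u j]ffunE; ring.
  rewrite 2!sum_unit_vec M0 !mulr0 add0r.
  under eq_bigr => j _ do rewrite mulrC [site_vec v u j]ffunE.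
  by rewrite sum_unit_vec mulrC.
transitivity (r * gstate M d y * chi (2^-1 * a * L ^+ 2) *
    \sum_u chi (s * (u - a * L) ^+ 2)).
  rewrite mulr_sumr; apply: eq_bigr => u _; rewrite gstateD // gv.
  have -> : \sum_i site_vec v u i * \sum_j M i j * y j = u * L0.
    rewrite -(sum_unit_vec (fun i => \sum_j M i j * y j)).
    by apply: eq_bigr => i _; rewrite ffunE.
  have E : chi (s * (y v - (y v + u)) ^+ 2) * chi (d v * u) * chi (u * L0) =
      chi (2^-1 * a * L ^+ 2) * chi (s * (u - a * L) ^+ 2).
    rewrite -!chiD; congr chi.
    have -> : s * (u - a * L) ^+ 2 =
        s * u ^+ 2 - s * (2 * a) * u * L + s * (2 * a) * 2^-1 * a * L ^+ 2.
      have -> : s * (2 * a) * 2^-1 = s * a * (2 * 2^-1) by ring.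
      by rewrite divff ?two_neq0 //; ring.
    by rewrite as1 /L; ring.
  rewrite /conv_op -/r -[RHS]mulrA -E; ring.
(* Translation invariance removes [y]: what remains is a quadratic Gauss sum, part of the overall
   scalar. *)
have -> : \sum_u chi (s * (u - a * L) ^+ 2) = K.
  rewrite (reindex_inj (addIr (a * L))).
  by apply: eq_bigr => u _; rewrite addrK.
have E : gstate M d y * chi (2^-1 * a * L ^+ 2) =
    chi (2^-1 * a * d v ^+ 2) * gstate (\matrix_(j, k) (M j k + a * M v j * M v k))
      (fun j => d j + a * d v * M v j) y.
  rewrite /gstate -!chiD; congr chi.
  have -> : \sum_j (d j + a * d v * M v j) * y j = \sum_j d j * y j + a * d v * L0.
    rewrite /L0 mulr_sumr -big_split /=; apply: eq_bigr => j _; ring.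
  have -> : quad (\matrix_(j, k) (M j k + a * M v j * M v k)) y =
      quad M y + 2^-1 * a * L0 ^+ 2.
    rewrite /quad -mulrA -mulrDr; congr (_ * _).
    have -> : a * L0 ^+ 2 = \sum_j \sum_k a * M v j * M v k * y j * y k.
      rewrite expr2 {1}/L0 mulr_suml mulr_sumr; apply: eq_bigr => j _.
      rewrite /L0 !mulr_sumr; apply: eq_bigr => k _; ring.
    rewrite -big_split; apply: eq_bigr => j _; rewrite -big_split /=.
    by apply: eq_bigr => k _; rewrite mxE; ring.
  have {1}-> : L = L0 + d v by [].
  have -> : 2^-1 * a * (L0 + d v) ^+ 2 =
    2^-1 * a * L0 ^+ 2 + 2^-1 * a * d v ^+ 2 + (2 * 2^-1) * a * d v * L0 by ring.
  by rewrite divff ?two_neq0 //; ring.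
by rewrite -[RHS]mulrA -E; ring.
Qed.

Lemma LC_equiv_step M N d e : label_matrix M -> graph_step M N ->
  label_matrix N /\ LC_equiv (gstate M d) (gstate N e).
Proof.
move=> lM [v [[b [b0 ->]]|[a ->]]].
  have cE i j : circ_op M v b i j =
      (if i == v then b else 1) * M i j * (if j == v then b else 1).
    by rewrite /circ_op /Ivb mul_mx_diag mul_diag_mx !mxE.
  split.
    case: (lM) => _ M0; split=> [|i]; last by rewrite cE M0 mulr0 mul0r.
    by apply/matrixP=> i j; rewrite mxE !cE (label_matrix_sym lM j i); ring.
  apply: (@LC_equiv_monomial _ _ (fun i => if i == v then b else 1)) => [i|i j _] //.
  by case: ifP => _ //; exact: oner_neq0.
split; first exact: star_label_matrix.
have one0 (i : 'I_n) : 1 != 0 :> 'F_p by exact: oner_neq0.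
(* The Gaussian parameter involves the inverse of [a]; for [a = 0] the off-diagonal labels do not
   change. *)
have [->|a0] := eqVneq a 0.
  apply: (LC_equiv_monomial _ _ one0) => i j /negPf ij.
  by rewrite mxE ij !mul0r addr0 mul1r mulr1.
apply: LC_equiv_trans (LC_equiv_conv v d lM a0) _.
apply: (LC_equiv_monomial _ _ one0) => i j /negPf ij.
by rewrite !mxE ij mul1r mulr1.
Qed.

Lemma LC_equiv_reach M N d e : label_matrix M -> graph_reach M N ->
  LC_equiv (gstate M d) (gstate N e).
Proof.
(* Unfolding the path from [M] onwards lets each step pass on [label_matrix]. *)
move=> lM reach; have {}reach := clos_rt_rt1n _ _ _ _ reach.
elim: {M N} reach d lM => [M|M M' N step _ IH] d lM.
  apply: (@LC_equiv_monomial _ _ (fun=> 1)) => [i|i j _]; first exact: oner_neq0.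
  by rewrite mul1r mulr1.
have [lM' LC] := LC_equiv_step d d lM step.
exact: LC_equiv_trans LC (IH d lM').
Qed.

(** * From a local Clifford equivalence to a local symplectic map *)

(** The [i]-th generator for [M] is carried to a multiple of [X(A)Z(B)], where [A] and [B] are the
    transformed X- and Z-parts of row [i]. It fixes [gstate N e] up to a scalar, and the translation
    law of that state forces [B = A N]. *)
Lemma LC_equiv_local_symplectic M N d e (hs : 'I_n -> op 'F_p) (lam : CC) :
  label_matrix M -> label_matrix N -> (forall i, clifford (hs i)) -> lam != 0 ->
  (forall y, opapply (tensorop hs) (gstate M d) y = lam * gstate N e y) ->
  exists al be ga de, local_symplectic M N al be ga de.
Proof.
move=> lM lN hC lam0 hE.
have sM := label_matrix_sym lM; have sN := label_matrix_sym lN.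
have /fin_all_exists[al] := fun i => clifford_symplectic (hC i).
move=> /fin_all_exists[be /fin_all_exists[ga /fin_all_exists[de hS]]].
exists al, be, ga, de; split=> [i|i k]; first by case: (hS i).
pose A l := unit_vec p i l * al l + M i l * ga l.
pose B l := unit_vec p i l * be l + M i l * de l.
have uE (F : 'I_n -> 'F_p) l : F i *+ (i == l) = unit_vec p i l * F l.
  by rewrite ffunE mulr_natl; case: eqVneq => [->|].
rewrite uE -/(B k); under eq_bigr => l _ do rewrite uE -/(A l).
have /fin_all_exists2[c c0 hc] l := (hS l).2 (unit_vec p i l) (M i l).
pose Av : basis_n p n := [ffun l => - A l].
pose c' := \prod_l c l * gstate M d (unit_vec p i) .
have shift y : gstate N e y = c' * chi (\sum_l B l * y l) * gstate N e (y + Av).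
  apply: (mulfI lam0); rewrite mulrCA -!hE /opapply.
  (* After this shift [gstateD] produces the phase [chi (M i l * x l)] at each site, as the
     intertwining relation [hc] requires. *)
  rewrite (reindex_inj (addIr (unit_vec p i))) mulr_sumr; apply: eq_bigr => x _.
  rewrite gstateD // sum_unit_vec1 chi_sum /c' chi_sum.
  have -> : tensorop hs y (x + unit_vec p i) =
      \prod_l hs l (y l) (x l + unit_vec p i l).
    by apply: eq_bigr => l _; rewrite ffunE.
  rewrite mulrC -[X in X = _]mulrA [X in _ * X]mulrC -big_split /=.
  under eq_bigr => l _ do rewrite hc -/(A l) -/(B l).
  rewrite !big_split /= /tensorop.
  have -> : \prod_l hs l ((y + Av) l) (x l) = \prod_l hs l (y l - A l) (x l).
    by apply: eq_bigr => l _; rewrite !ffunE.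
  ring.
have {}shift y : c' * gstate N e Av *
    chi (\sum_l B l * y l - \sum_l A l * \sum_k N l k * y k) = 1.
  apply: (mulIf (gstate_neq0 N e y)); rewrite mul1r [RHS]shift gstateD // chiD.
  rewrite (_ : - _ = \sum_l Av l * \sum_k N l k * y k); first by ring.
  by rewrite -sumrN; apply: eq_bigr => l _; rewrite ffunE mulNr.
have z0 (F : 'I_n -> 'F_p) : \sum_l F l * (0 : basis_n p n) l = 0.
  by rewrite big1 // => l _; rewrite ffunE mulr0.
(* At [y = 0] the prefactor is seen to be 1; at [y = unit_vec p k], injectivity of [chi] then yields
   the equation in column [k]. *)
have := shift 0; rewrite z0 [X in 0 - X]big1 => [|l _]; last by rewrite z0 mulr0.
rewrite subrr chi0 mulr1 => cE.
have := shift (unit_vec p k); rewrite cE mul1r -chi0 => /chi_inj/eqP.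
rewrite subr_eq0 => /eqP.
rewrite sum_unit_vecr => ->.
by apply: eq_bigr => l _; rewrite sum_unit_vecr.
Qed.

End Qupits.

Theorem theorem5 (p : nat) (n : nat) (M N : 'M['F_p]_n)
  (psiG psiH : basis_n p n -> CC) :
  prime p -> odd p ->
  label_matrix M -> label_matrix N ->
  graph_state M psiG -> graph_state N psiH ->
  (LC_equiv psiG psiH <-> graph_reach M N).
Proof.
move=> p_prime p_odd lM lN gG gH.
have [a [d [a0 GE]]] := graph_stateE p_prime p_odd lM gG.
have [b [e [b0 HE]]] := graph_stateE p_prime p_odd lN gH.
split=> [[hs [hC [lam hE]]]|reach].
  have gE y : opapply (tensorop hs) (gstate M d) y = lam * b / a * gstate N e y.
    apply: (mulfI a0); rewrite -opapplyZ -(eq_opapply _ GE) hE HE.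
    by rewrite [RHS]mulrA [a * _]mulrC divfK // mulrA.
  have lam0 : lam * b / a != 0.
    (* A zero scalar would make the image under unitaries vanish, and with it [gstate M d]. *)
    apply: contraNneq (gstate_neq0 p_prime p_odd M d 0) => lam0; apply/eqP.
    apply: (@opapply_unitary0 p n hs (gstate M d)) => [i|y]; first by case: (hC i).
    by rewrite gE lam0 mul0r.
  have [al [be [ga [de ls]]]] := LC_equiv_local_symplectic p_prime p_odd lM lN hC lam0 gE.
  exact: local_symplectic_reach ls.
have [hs [hC [lam hE]]] := LC_equiv_reach p_prime p_odd d e lM reach.
exists hs; split=> //; exists (a * lam / b) => y.
by rewrite (eq_opapply _ GE) opapplyZ hE HE mulrA (mulrA _ b) divfK.
Qed.
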